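(* Let $n\ge 1$ be an integer. The symmetric group $S_n$ is $(\ast\ast)$-coverable if and only if $3\leq n\leq 6$.
   Context: For a subgroup $H$ of a group $G$ and $g\in G$, $H^g=g^{-1}Hg$. A covering of a finite group $G$ is a set of proper subgroups of $G$ whose set-theoretical union is $G$ and such that no member of the set is contained in another (different) member of the set. A finite group $G$ is called $(\ast\ast)$-coverable if there exist proper subgroups $H,K$ of $G$ such that $\delta=\{H^g,K^g: g\in G\}$ is a covering of $G$. Here $S_n$ denotes the symmetric group on $\{1,\ldots,n\}$. *)

(* Defs.v *)
From mathcomp Require Import all_boot all_fingroup all_solvable.

Set Implicit Arguments.
Unset Strict Implicit.
Unset Printing Implicit Defensive.

Local Open Scope group_scope.

Definition covering (gT : finGroupType) (G : {group gT})
    (D : {set {group gT}}) : Prop :=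
  [/\ forall H : {group gT}, H \in D -> H \proper G,
      \bigcup_(H in D) (H : {set gT}) = G
    & forall H K : {group gT},
        H \in D -> K \in D -> H <> K -> ~ (H \subset K)].

(* [H :^ g] is [g^-1 H g]. *)
Definition starstar_coverable (gT : finGroupType) (G : {group gT}) : Prop :=
  exists H K : {group gT},
    [/\ H \proper G, K \proper G
      & covering G ([set (H :^ g)%G | g in G] :|: [set (K :^ g)%G | g in G])].

(* Main.v *)
(* [S_n], [n >= 7]: let [H] and [K] be proper subgroups whose conjugates cover
   [S_n], with an [n]-cycle in [H].  In a transitive proper subgroup, the
   relation "[(x y)] belongs to the subgroup" has classes of a common size [b],
   and the presence of an [(n - k)]-cycle with [2 k <= n] forces [b] to divide
   [k] as soon as the subgroup contains a transposition at all.  Applied to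
   powers of elements of cycle type (n-2,2), (n-3,3), (n-3,2,1), (n-5,3,2) and
   (n-7,5,2), this excludes the case where [H] contains no [(n-1)]-cycle, and
   otherwise makes [K] intransitive with an invariant set of size 2 or 3.  In
   the latter case [H] is 2-transitive and contains an odd permutation and all
   cycle types without a partial sum equal to that size; these give a 3-cycle in
   [H], directly for size 2, and for size 3 because a double transposition
   [(u v)(p q)] conjugated by an [(n-2)]-cycle [z] fixing [u] and [v] yields
   either a 3-cycle or a perfect matching of the other points by the pairs
   [{r, z^(n/2-1) r}], which some further element of [H] cannot respect.

   [S_3], ..., [S_6] are covered by the conjugates of the automorphism groups of
   two relations; the covering is checked by computation.  No member contains
   another, since [S_n] is not covered by the conjugates of a single proper
   subgroup: the latter would contain an [n]-cycle, an [(n-1)]-cycle and a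
   transposition. *)
Require Import Defs.
From mathcomp Require Import all_boot all_fingroup all_solvable.
From mathcomp Require Import zify.

Set Implicit Arguments.
Unset Strict Implicit.
Unset Printing Implicit Defensive.

Local Open Scope group_scope.

Section CycleType.
Variable T : finType.
Implicit Types (s t : {perm T}) (c : seq T) (css : seq (seq T)) (ls : seq nat).
Implicit Types (A : {set T}) (H K : {group {perm T}}).

(** * Cycles, cycle types and powers that isolate one cycle *)

Lemma fcycle_expg s c x k :
  fcycle s c -> uniq c -> x \in c -> (s ^+ k) x = (s ^+ (k %% size c)) x.
Proof.
move=> sc Uc xc; rewrite {1}(divn_eq k (size c)) addnC expgD mulnC expgM permM.
suffices fix_pow m y : y \in c -> (s ^+ size c ^+ m) y = y.
  apply: fix_pow; rewrite permX -(fconnect_cycle sc xc).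
  exact: fconnect_iter.
move=> yc; elim: m => [|m IHm]; first by rewrite perm1.
rewrite expgSr permM IHm permX -(order_cycle sc Uc yc).
by rewrite iter_order //; apply: perm_inj.
Qed.

Lemma fcycle_conjg s t c : fcycle s c -> fcycle (s ^ t) (map t c).
Proof.
case: c => //= x c; rewrite -map_rcons path_map => sc.
by apply: sub_path sc => y z /= /eqP <-; rewrite permJ.
Qed.

Lemma fcycle_mem s c x k : fcycle s c -> x \in c -> (s ^+ k) x \in c.
Proof.
by move=> sc xc; rewrite permX -(fconnect_cycle sc xc) fconnect_iter.
Qed.

(** Fixed points count as parts equal to 1. The parts are listed in order, so that one of them can
    be singled out by its place in a concatenation. *)
Definition has_shape s ls := exists css,
  [/\ perm_eq (flatten css) (enum T), all (fun c => fcycle s c) css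
    & map size css = ls].

Definition contains_shape (H : {set {perm T}}) ls :=
  exists2 s, s \in H & has_shape s ls.

Lemma has_shapeJ s t ls : has_shape s ls -> has_shape (s ^ t) ls.
Proof.
case=> css [pE /allP sE dE]; exists (map (map t) css); split.
- rewrite -map_flatten; apply: uniq_perm.
  + rewrite map_inj_uniq ?(perm_uniq pE) ?enum_uniq //; exact: perm_inj.
  + exact: enum_uniq.
  move=> x; rewrite -[x](permKV t) mem_map ?(perm_mem pE) ?mem_enum //.
  exact: perm_inj.
- by apply/allP=> _ /mapP[c cc ->]; apply/fcycle_conjg/sE.
by rewrite -map_comp -dE; apply: eq_map => c; rewrite /= size_map.
Qed.

Lemma cycle_perm_exists css : uniq (flatten css) ->
  exists2 s : {perm T}, all (fun c => fcycle s c) css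
    & forall x, x \notin flatten css -> s x = x.
Proof.
elim: css => [|c css IHcss] /=; first by exists 1 => // x _; rewrite perm1.
rewrite cat_uniq => /and3P[Uc /hasPn dis /IHcss[s sE sfix]].
pose t := perm (can_inj (prev_next Uc)).
have tE x : t x = next c x by rewrite permE.
have tfix x : x \notin c -> t x = x by rewrite tE next_nth => /negPf->.
have disc x : x \in c -> x \notin flatten css.
  by apply: contraL => xF; apply: dis.
exists (t * s).
  apply/andP; split.
    apply: cycle_from_next => // x xc; apply/eqP.
    by rewrite permM tE sfix // disc // mem_next.
  apply/allP=> d dE; have := allP sE d dE.
  apply: (@sub_in_cycle _ [in d]); last exact/allP.
  move=> x y xd yd /= /eqP <-; rewrite permM tfix //.
  by apply: dis; apply/flattenP; exists d.
move=> x; rewrite mem_cat negb_or => /andP[xc xF].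
by rewrite permM tfix ?sfix.
Qed.

Lemma shape_exists ls : sumn ls = #|T| -> exists s, has_shape s ls.
Proof.
move=> sz; have szE : size (enum T) = sumn ls by rewrite -cardE sz.
have fE : flatten (reshape ls (enum T)) = enum T by rewrite reshapeKr // szE.
have [|s sE _] := @cycle_perm_exists (reshape ls (enum T)).
  by rewrite fE enum_uniq.
exists s, (reshape ls (enum T)).
by split=> //; [rewrite fE | apply: reshapeKl; rewrite szE].
Qed.

Lemma uniq_mem_flatten css c : uniq (flatten css) -> c \in css -> uniq c.
Proof.
move=> Uf /splitPr ccss; case: ccss Uf => css1 css2.
by rewrite flatten_cat /= !cat_uniq => /and3P[_ _ /andP[]].
Qed.

Definition contains_cycle (H : {set {perm T}}) l := exists t c,
  [/\ t \in H, uniq c, size c = l, fcycle t c & forall x, x \notin c -> t x = x].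

Lemma shape_split s ls1 l ls2 : has_shape s (ls1 ++ l :: ls2) ->
  exists c, [/\ uniq c, size c = l, fcycle s c
  & forall M x, all (dvdn^~ M) (ls1 ++ ls2) -> x \notin c -> (s ^+ M) x = x].
Proof.
case=> css [pE sE dE].
have Uf : uniq (flatten css) by rewrite (perm_uniq pE) enum_uniq.
have [css1 [c [css2 [cssE dE1 dc dE2]]]] : exists css1 c css2,
    [/\ css = css1 ++ c :: css2, map size css1 = ls1, size c = l
      & map size css2 = ls2].
  have := cat_take_drop (size ls1) css.
  have dE' : map size (drop (size ls1) css) = l :: ls2.
    by rewrite map_drop dE drop_size_cat.
  case E: drop dE' => [|c css2] //= [dc dE2] cssE.
  exists (take (size ls1) css), c, css2; split=> //.
  by rewrite map_take dE take_size_cat.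
have cin : c \in css by rewrite cssE mem_cat inE eqxx orbT.
exists c; split=> //; [exact: uniq_mem_flatten cin | exact: (allP sE) |].
move=> M x dM xc.
have: x \in flatten css by rewrite (perm_mem pE) mem_enum.
case/flattenP=> d din xd.
have Ud := uniq_mem_flatten Uf din; have sd := allP sE d din.
rewrite (fcycle_expg _ sd Ud xd).
suffices /eqP-> : M %% size d == 0 by rewrite perm1.
apply: (allP dM); rewrite -dE1 -dE2 -map_cat map_f //.
move: din; rewrite cssE !mem_cat inE orbCA => /predU1P[dc'|//].
by rewrite dc' (negPf xc) in xd.
Qed.

(** The Chinese remainder exponent [M] is 1 modulo [l] and 0 modulo [d]: [s ^+ M] agrees with [s] on
    the chosen cycle and is trivial on all the others. *)
Lemma isolate_cycle (H : {group {perm T}}) ls1 l ls2 d :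
  contains_shape H (ls1 ++ l :: ls2) -> all (dvdn^~ d) (ls1 ++ ls2) ->
  coprime l d -> contains_cycle H l.
Proof.
case=> s sH /shape_split[c [Uc szc sc fixc]] dvd_d co.
pose M := chinese l d 1 0; exists (s ^+ M), c; split=> //.
- exact: groupX.
- apply: cycle_from_next => // x xc; apply/eqP; rewrite (nextE sc xc).
  by rewrite (fcycle_expg _ sc Uc xc) szc chinese_modl // -szc -fcycle_expg.
move=> x; apply: fixc; apply: sub_all dvd_d => k /dvdn_trans; apply.
by rewrite /dvdn chinese_modr // mod0n.
Qed.

(** * Invariant sets, parity and transitivity *)

Fixpoint subset_sum ls a := if ls is l :: ls' then
  subset_sum ls' a || (l <= a) && subset_sum ls' (a - l) else a == 0%N.

(** An invariant set is a union of cycles: once it meets a cycle, iterating [s] puts all of that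
    cycle in it. *)
Lemma invariant_card_shape A s ls :
  {homo s : x / x \in A} -> has_shape s ls -> subset_sum ls #|A|.
Proof.
move=> sA [css [pE sE dE]].
have -> : #|A| = count [in A] (flatten css).
  by rewrite (seq.permP pE) enumT cardE -size_filter; apply: erefl.
elim: css ls sE dE {pE} => [|c css IHcss] ls /= => [_ <- //|/andP[sc sE] <-].
have IH := IHcss _ sE erefl; rewrite /= count_cat.
have [/hasP[x xc xA]|] := boolP (has [in A] c).
  apply/orP; right; suffices /eqP-> : count [in A] c == size c.
    by rewrite leq_addr addKn.
  rewrite -all_count; apply/allP=> y; rewrite -(fconnect_cycle sc xc).
  by move/iter_findex <-; elim: findex => //= k IHk; apply: sA.
by rewrite has_count -leqNgt leqn0 => /eqP->; rewrite add0n IH.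
Qed.

Lemma cycle_generates (t : {perm T}) c x y : fcycle t c -> x \in c ->
  y \in c -> exists i, (t ^+ i) x = y.
Proof.
move=> tc xc; rewrite -(fconnect_cycle tc xc) => /iter_findex <-.
by eexists; rewrite permX.
Qed.

(** Following [t] by [tperm x y], with [y] the image of the first point [x], removes [x] from the
    cycle and changes the parity. *)
Lemma odd_cycle (t : {perm T}) c : uniq c -> fcycle t c ->
  (forall x, x \notin c -> t x = x) -> 0 < size c -> odd_perm t = ~~ odd (size c).
Proof.
case: c => // x c; elim: c x t => [|y c IHc] x t Uc tc tfix _ /=.
  have -> : t = 1 => [|]; last by rewrite odd_perm1.
  apply/permP=> y; rewrite perm1; have [|/tfix//] := boolP (y \in [:: x]).
  by rewrite inE => /eqP->; move: tc => /= /andP[/eqP].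
have [tx tl] : t x = y /\ t (last y c) = x.
  by move: tc; rewrite /= rcons_path => /and3P[/eqP-> _ /eqP->].
have xyc : x \notin y :: c by case/andP: Uc.
have xy : x != y by move: xyc; rewrite inE negb_or => /andP[].
have := IHc y (t * tperm x y).
rewrite odd_permM odd_tperm xy addbT /= negbK => <- //.
- by rewrite negbK.
- by case/andP: Uc.
- move: (tc) => /=; rewrite !rcons_path /= permM tl tpermL eqxx andbT.
  case/andP=> _ tp; rewrite eqxx andbT.
  apply: (@sub_in_path _ [in y :: c] _ _ _ _ _ _ tp); last exact/allP.
  move=> a b ac bc /= /eqP tab; rewrite permM tab tpermD //.
    by apply: contraNneq xyc => ->.
  apply: contraNneq xyc => yb; suffices <- : a = x by [].
  by apply: (@perm_inj _ t); rewrite tx tab.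
move=> a ac; rewrite permM; have [->|ax] := eqVneq a x; first by rewrite tx tpermR.
have -> : t a = a by rewrite tfix // in_cons negb_or ax.
rewrite tpermD //; first by rewrite eq_sym.
by apply: contraNneq ac => <-; rewrite inE eqxx.
Qed.

Definition point_transitive (H : {set {perm T}}) :=
  forall x y, exists2 h, h \in H & h x = y.

Definition pair_transitive (H : {set {perm T}}) := forall x y x' y',
  x != y -> x' != y' -> exists2 h, h \in H & h x = x' /\ h y = y'.

Lemma transitive_or_invariant H : point_transitive H \/
  exists2 A : {set T}, 0 < #|A| < #|T|
    & forall h, h \in H -> {homo h : x / x \in A}.
Proof.
have [/forallP tr|] := boolP [forall x, orbit 'P H x == [set: T]].
  left=> x y; have: y \in orbit 'P H x by rewrite (eqP (tr x)).
  by case/orbitP=> h hH <-; exists h.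
rewrite negb_forall => /existsP[x ntr]; right; exists (orbit 'P H x).
  rewrite card_gt0 -cardsT proper_card ?properT // andbT.
  by apply/set0Pn; exists x; apply: orbit_refl.
by move=> h hH y yx; rewrite -[h y]/('P%act y h) orbit_actr.
Qed.

Lemma ncycle_transitive H : contains_cycle H #|T| -> point_transitive H.
Proof.
case=> t [c [tH Uc szc tc _]] x y.
have inc z : z \in c.
  have : c =i T by apply/subset_cardP; rewrite ?(card_uniqP Uc) //; apply/subsetP.
  by move->.
have [i tixy] := cycle_generates tc (inc x) (inc y).
by exists (t ^+ i); rewrite ?groupX.
Qed.

(** * Transpositions in a transitive group *)

Lemma transposition2 H : contains_cycle H 2 ->
  exists x y, x != y /\ tperm x y \in H.
Proof.
case=> t [c [tH Uc szc tc tfix]].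
case: c szc Uc tc tfix => [|x [|y []]] //= _ Uc /and3P[/eqP tx /eqP ty _] tfix.
exists x, y; split; first by move: Uc; rewrite inE andbT.
suffices <- : t = tperm x y by [].
apply/permP=> z; have [->|zx] := eqVneq z x; first by rewrite tpermL.
have [->|zy] := eqVneq z y; first by rewrite tpermR.
by rewrite tfix ?tpermD 1?eq_sym // !inE negb_or zx.
Qed.

Lemma tperm_groupT H : (forall x y, tperm x y \in H) -> H = [set: {perm T}]%G.
Proof.
move=> tH; apply/val_inj/setP=> s /=; rewrite inE.
have [ts -> _] := prod_tpermP s.
by apply: group_prod => i _; apply: tH.
Qed.

Lemma tperm_rel_trans H y x z :
  tperm x y \in H -> tperm y z \in H -> tperm x z \in H.
Proof.
have [-> //|xy] := eqVneq x y; have [<- //|yz] := eqVneq y z.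
have [->|xz Hxy Hyz] := eqVneq x z; first by rewrite tperm1.
have <- : tperm x y ^ tperm y z = tperm x z.
  by rewrite tpermJ tpermL tpermD // eq_sym.
exact: groupJ.
Qed.

Lemma proper_dvdn_half b n l : l < b -> b %| n -> b < n -> ~~ (n <= 2 * l)%N.
Proof. by move=> lb /dvdnP[[|[|k]] ->]; rewrite ?mulSn; lia. Qed.

(* The blocks are the classes of the relation [tperm x y \in H]; the fixed
   points of a cycle longer than half the degree form a union of blocks. *)
Lemma transposition_block H : point_transitive H -> contains_cycle H 2 ->
  H <> [set: {perm T}]%G ->
  exists b, [/\ 1 < b < #|T|, b %| #|T|
    & forall l, contains_cycle H l -> #|T| <= 2 * l -> b %| #|T| - l].
Proof.
move=> trH /transposition2[x0 [y0 [xy0 Hxy0]]] nHT.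
pose B x := [set y | tperm x y \in H].
have cardB x y : #|B x| = #|B y|.
  have [h hH <-] := trH x y; rewrite -(card_imset _ (@perm_inj _ h)).
  congr #|pred_of_set _|; apply/setP=> z; rewrite -[z](permKV h).
  rewrite mem_imset; last exact: perm_inj.
  by rewrite !inE -tpermJ memJ_norm // (subsetP (normG H)).
have BC x y : (y \in B x) = (x \in B y) by rewrite !inE tpermC.
have Bxx x : x \in B x by rewrite inE tperm1.
have Btr y x z : y \in B x -> z \in B y -> z \in B x.
  by rewrite !inE; apply: tperm_rel_trans.
have Beq x y : y \in B x -> B x = B y.
  by move=> yx; apply/setP=> z; apply/idP/idP; apply: Btr => //; rewrite BC.
have dvdB (F : {set T}) : (forall x y, x \in F -> y \in B x -> y \in F) ->
    #|B x0| %| #|F|.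
  move=> clF; have eqR : {in F & &, equivalence_rel [rel x y | y \in B x]}.
    by move=> x y z _ _ _ /=; split=> // yx; rewrite (Beq x y).
  rewrite (@card_uniform_partition _ #|B x0| _ _ _ (equivalence_partitionP eqR)).
    exact: dvdn_mull.
  move=> _ /imsetP[x xF ->]; rewrite (cardB x0 x); congr #|pred_of_set _|.
  apply/setP=> y; rewrite 2!inE /= andb_idl ?inE // => Hxy.
  by apply: (clF x); rewrite ?inE.
have ltB : #|B x0| < #|T|.
  rewrite -cardsT proper_card // properT; apply/eqP=> B0; apply: nHT.
  apply: tperm_groupT => x y; have : y \in B x0 by rewrite B0 inE.
  have : x \in B x0 by rewrite B0 inE.
  by move/Beq->; rewrite inE.
have dvdT : #|B x0| %| #|T| by rewrite -cardsT; apply: dvdB => x y; rewrite !inE.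
exists #|B x0|; split => //.
  by rewrite ltB andbT (cardD1 x0) Bxx (cardD1 y0) !inE eq_sym xy0 Hxy0.
move=> l [t [c [tH Uc szc tc tfix]]] le2l.
have cF : #|T| - l = #|~: [set x in c]|.
  by rewrite cardsCs setCK cardsE (card_uniqP Uc) szc.
rewrite cF; apply: dvdB => x y; rewrite !inE => xc xy; apply: contraL le2l => yc.
(* The powers of [t] fix [x] and carry [y] over all of [c]. The class of [x] would thus have more
   than [l] elements, over half the degree, which is too many for a proper divisor. *)
have cB : x |: [set z in c] \subset B x.
  apply/subsetP=> z; rewrite !inE => /predU1P[->|zc]; first by rewrite tperm1.
  have [i <-] := cycle_generates tc yc zc.
  have tix : (t ^+ i) x = x.
    by elim: i => [|i IHi]; rewrite ?perm1 // expgSr permM IHi tfix.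
  by rewrite -{1}tix -tpermJ groupJ // groupX.
have := subset_leq_card cB; rewrite cardsU1 inE xc cardsE (card_uniqP Uc) szc.
by rewrite (cardB x x0) => ltl; apply: proper_dvdn_half dvdT ltB.
Qed.

(** * 2-transitive groups and 3-cycles *)

Lemma perm_fix_expg (t : {perm T}) x i : t x = x -> (t ^+ i) x = x.
Proof. by move=> tx; elim: i => [|i IHi]; rewrite ?perm1 // expgSr permM IHi. Qed.

(** The given cycle misses a single point [a]. Moving [x] and [x'] to [a] leaves [y] and [y'] on the
    cycle, where a power of it joins them. *)
Lemma cycle_pair_transitive H : point_transitive H ->
  contains_cycle H #|T|.-1 -> pair_transitive H.
Proof.
move=> trH [t [c [tH Uc szc tc tfix]]] x y x' y' xy xy'.
have /cards1P[a aE] : #|~: [set z in c]| == 1%N.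
  rewrite cardsCs setCK cardsE (card_uniqP Uc) szc.
  by rewrite (cardD1 x) /= subSnn.
have notc z : (z \notin c) = (z == a).
  by have /setP/(_ z) := aE; rewrite !inE.
have [h hH hx] := trH x a; have [h' hH' hx'] := trH x' a.
have inc (g : {perm T}) z z' : z != z' -> g z = a -> g z' \in c.
  by move=> zz' gz; rewrite -[_ \in c]negbK notc -gz (inj_eq perm_inj) eq_sym.
have [i ti] := cycle_generates tc (inc _ _ _ xy hx) (inc _ _ _ xy' hx').
exists (h * t ^+ i * h'^-1); first by rewrite !groupM ?groupX ?groupV.
rewrite !permM hx ti perm_fix_expg; last by rewrite tfix // notc.
by rewrite -hx' !permK.
Qed.

Lemma three_cycle H : contains_cycle H 3 ->
  exists x y z, uniq [:: x; y; z] /\ tperm x y * tperm x z \in H.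
Proof.
case=> t [c [tH Uc szc tc tfix]].
case: c szc Uc tc tfix => [|x [|y [|z []]]] //= _ Uc.
case/and4P=> /eqP tx /eqP ty /eqP tz _ tfix; exists x, y, z; split=> //.
move: Uc; rewrite !inE negb_or !andbT => /andP[/andP[xy xz] yz].
suffices <- : t = tperm x y * tperm x z by [].
apply/permP=> u; rewrite permM; have [->|ux] := eqVneq u x.
  by rewrite tpermL tpermD // eq_sym.
have [->|uy] := eqVneq u y; first by rewrite tpermR tpermL.
have [->|uz] := eqVneq u z; first by rewrite (tpermD xz) // tpermR.
by rewrite tfix ?inE ?negb_or ?ux ?uy // !tpermD // eq_sym.
Qed.

(** The common factor [(u v)] cancels; for distinct [p], [q], [r] a 3-cycle remains. *)
Lemma tperm_pair_quotient H u v p q r : tperm u v * tperm p q \in H ->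
  tperm u v * tperm p r \in H -> tperm p q * tperm p r \in H.
Proof.
move=> Hq Hr; have -> : tperm p q * tperm p r =
    (tperm u v * tperm p q)^-1 * (tperm u v * tperm p r).
  by rewrite invMg !tpermV -mulgA (mulgA (tperm u v)) tperm2 mul1g.
by rewrite groupM ?groupV.
Qed.

(** For distinct points the product is the 3-cycle [(x y z)]. By 2-transitivity any two points
    extend to such a 3-cycle in [H]; products and conjugates then make the third point arbitrary. *)
Lemma three_cycles_all H x0 y0 z0 : pair_transitive H -> uniq [:: x0; y0; z0] ->
  tperm x0 y0 * tperm x0 z0 \in H ->
  forall x y z, x != y -> x != z -> tperm x y * tperm x z \in H.
Proof.
move=> tr2 U0 H0.
have [xy0 xz0 yz0] : [/\ x0 != y0, x0 != z0 & y0 != z0].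
  by move: U0; rewrite /= !inE negb_or andbT => /andP[/andP[-> ->]].
pose P x y z := tperm x y * tperm x z \in H.
have PC x y z : P x y z -> P x z y.
  by rewrite /P -groupV invMg !tpermV.
have Ptr x y z w : P x y z -> P x z w -> P x y w.
  rewrite /P => Pz Pw.
  by rewrite -(mulgKV (tperm x z) (tperm x y)) tpermV -mulgA groupM.
have Prot x y z : x != y -> y != z -> x != z -> P x y z -> P y z x.
  move=> xy yz xz Pxyz; rewrite /P.
  suffices -> : tperm y z * tperm y x = tperm x y * tperm x z by [].
  rewrite [tperm y x]tpermC conjgC tpermJ tpermR.
  by rewrite tpermD.
have Pex x y : x != y -> exists z, [/\ x != z, y != z & P x y z].
  move=> xy; have [h hH [hx hy]] := tr2 _ _ _ _ xy0 xy.
  exists (h z0); rewrite -{1}hx -{1}hy !(inj_eq perm_inj) xz0 yz0; split=> //.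
  by rewrite /P -hx -hy -!tpermJ -conjMg groupJ.
move=> x y w xy xw; rewrite -/(P x y w).
have [->|yw] := eqVneq y w; first by rewrite /P tperm2.
have [z [xz yz Pxyz]] := Pex x y xy.
have [v [xv wv Pxwv]] := Pex x w xw.
have [zw|zw] := eqVneq z w; first by rewrite -zw.
have [vy|vy] := eqVneq v y; first by apply: PC; rewrite -vy.
have [vz|vz] := eqVneq v z; first by apply: (Ptr _ _ z) => //; apply: PC; rewrite -vz.
(* Conjugation by [(x w v)] sends [x] to [w] and fixes [y] and [z]. *)
have Pwyz : P w y z.
  have := groupJ Pxyz Pxwv; rewrite conjMg !tpermJ !permM tpermL.
  by rewrite !(@tpermD _ _ _ w) ?(@tpermD _ _ _ y) ?(@tpermD _ _ _ z) // eq_sym.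
have wy : w != y by rewrite eq_sym.
have wz : w != z by rewrite eq_sym.
have Pyzw := Prot _ _ _ wy yz wz Pwyz.
have Pyzx := Prot _ _ _ xy yz xz Pxyz.
have yx : y != x by rewrite eq_sym.
have wx : w != x by rewrite eq_sym.
exact: Prot (Prot _ _ _ yw wx yx (Ptr _ _ _ _ (PC _ _ _ Pyzw) Pyzx)).
Qed.

(** The 3-cycles generate all products of two transpositions. As [t] is a product of an odd number
    of transpositions, [(x y) t] is in [H], hence so is [(x y)]. *)
Lemma odd_three_cycle_groupT H x0 y0 z0 t : pair_transitive H ->
  uniq [:: x0; y0; z0] -> tperm x0 y0 * tperm x0 z0 \in H ->
  t \in H -> odd_perm t -> H = [set: {perm T}]%G.
Proof.
move=> tr2 U0 H0 tH ot.
have H3 := three_cycles_all tr2 U0 H0.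
have H2 a b u v : a != b -> u != v -> tperm a b * tperm u v \in H.
  move=> ab uv; have [ac|ac] := eqVneq a u; first by rewrite -ac H3 // ac.
  have -> : tperm a b * tperm u v =
      (tperm a b * tperm a u) * (tperm u a * tperm u v).
    by rewrite (tpermC u a) -mulgA (mulgA (tperm a u)) tperm2 mul1g.
  by rewrite groupM ?H3 // eq_sym.
have Hprod ts : all dpair ts -> forall x y, x != y ->
    tperm x y ^+ odd (size ts) * \prod_(i <- ts) tperm i.1 i.2 \in H.
  elim: ts => [|[a b] ts IHts] /= => [_|/andP[ab /IHts{}IHts]] x y xy.
    by rewrite big_nil mulg1 group1.
  rewrite big_cons /= mulgA; case: (odd _) IHts => IHts /=.
    by rewrite mul1g; apply: IHts.
  by rewrite groupM ?H2 // -[X in X \in H]mul1g; apply: (IHts x y).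
have [ts tE tsD] := prod_tpermP t.
apply: tperm_groupT => x y; have [->|xy] := eqVneq x y; first by rewrite tperm1.
have := Hprod ts tsD x y xy; rewrite -tE.
by rewrite -(odd_perm_prod tsD) -tE ot groupMr.
Qed.

(** * Double transpositions and matchings *)

Lemma fcycle_expg_fix (t : {perm T}) c x k : fcycle t c -> uniq c -> x \in c ->
  ((t ^+ k) x == x) = (size c %| k).
Proof.
move=> tc Uc xc; rewrite (fcycle_expg k tc Uc xc) permX /dvdn.
have lt : k %% size c < fingraph.order t x.
  by rewrite (order_cycle tc Uc xc) ltn_mod; case: (c) xc.
apply/eqP/eqP=> [fx|-> //]; have := findex_iter lt.
by rewrite fx findex0.
Qed.

Definition no_three_cycle (H : {set {perm T}}) := forall x y z,
  uniq [:: x; y; z] -> tperm x y * tperm x z \notin H.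

Definition double_transposition (H : {set {perm T}}) := exists a b p q,
  uniq [:: a; b; p; q] /\ tperm a b * tperm p q \in H.

(** As [2 k] is 2 modulo 4, this power squares the 4-cycle and kills the other cycles. *)
Lemma four_cycle_double_transposition H ls1 ls2 (k : nat) :
  contains_shape H (ls1 ++ 4 :: ls2) -> all (dvdn^~ (2 * k)%N) (ls1 ++ ls2) ->
  odd k -> double_transposition H.
Proof.
case=> s sH /shape_split[c [Uc szc sc fixc]] dvd_k ok.
case: c szc Uc sc fixc => [|a [|b [|p [|q []]]]] // _ Uc sc fixc.
exists a, p, b, q; split.
  rewrite /= !inE !negb_or (eq_sym p b); move: Uc; rewrite /= !inE !negb_or.
  by case/and4P=> /and3P[-> -> ->] /andP[-> ->] ->.
suffices <- : s ^+ (2 * k)%N = tperm a p * tperm b q by rewrite groupX.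
have s2k x : x \in [:: a; b; p; q] -> (s ^+ (2 * k)%N) x = s (s x).
  move=> xc; rewrite (fcycle_expg _ sc Uc xc) /=.
  have -> : (2 * k) %% 4 = 2%N by lia.
  by rewrite permM.
have [[sa sb sp sq] [ap aq bp bq]] : [/\ s a = b, s b = p, s p = q & s q = a] /\
    [/\ a != p, a != q, b != p & b != q].
  move: sc Uc; rewrite /= !inE !negb_or.
  by case/and5P=> /eqP-> /eqP-> /eqP-> /eqP-> _ /and4P[/and3P[_ -> ->] /andP[-> ->]].
have [ab pq] : a != b /\ p != q.
  by move: Uc; rewrite /= !inE !negb_or; case/and4P=> /and3P[-> _ _] _ ->.
apply/permP=> x; rewrite permM.
have [->|xa] := eqVneq x a.
  by rewrite s2k ?inE ?eqxx // sa sb tpermL tpermD // eq_sym.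
have [->|xb] := eqVneq x b.
  by rewrite s2k ?inE ?eqxx ?orbT // sb sp (@tpermD _ _ _ b) ?tpermL // eq_sym.
have [->|xp] := eqVneq x p.
  by rewrite s2k ?inE ?eqxx ?orbT // sp sq tpermR tpermD // eq_sym.
have [->|xq] := eqVneq x q.
  by rewrite s2k ?inE ?eqxx ?orbT // sq sa (@tpermD _ _ _ q) ?tpermR // eq_sym.
rewrite fixc ?inE ?negb_or ?xa ?xb ?xp //.
by rewrite !tpermD // eq_sym.
Qed.

Lemma dvdn_double_half (i m : nat) :
  i != 0%N -> i < (2 * m)%N -> (2 * m)%N %| i + i -> i = m.
Proof. by move=> i0 im /dvdnP[[|[|k]]]; rewrite ?mulSn; lia. Qed.

(** Conjugating [(u v)(p q)] by the power [z ^+ i] that sends [p] to [q] gives [(u v)(q q')].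
    Without 3-cycles [q'] must be [p], so [2 m] divides [2 i] and [i = m]; powers of [z] then move
    the pair around the cycle. *)
Lemma double_transposition_matching H m u v :
  pair_transitive H -> no_three_cycle H -> double_transposition H ->
  contains_cycle H (2 * m)%N -> #|T| = (2 * m)%N.+2 -> u != v ->
  exists z c, [/\ z \in H, uniq c, size c = (2 * m)%N & fcycle z c] /\
    [/\ forall x, (x \notin c) = (x \in [:: u; v]),
        forall x, x \notin c -> z x = x
      & forall r, r \in c -> tperm u v * tperm r ((z ^+ m) r) \in H].
Proof.
move=> tr2 no3 [a [b [a' [b' [Uab Hab]]]]] [z0 [c0 [zH0 Uc0 szc0 zc0 fix0]]] cardT uv.
have /cards2P[u0 [v0 [uv0 fixE]]] : #|~: [set x in c0]| == 2%N.
  by rewrite cardsCs setCK cardsE (card_uniqP Uc0) szc0 cardT -addn2 addKn.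
have [h hH [hu hv]] := tr2 _ _ _ _ uv0 uv.
pose z := z0 ^ h; pose c := map h c0.
have zH : z \in H by rewrite groupJ.
have Uc : uniq c by rewrite map_inj_uniq //; apply: perm_inj.
have szc : size c = (2 * m)%N by rewrite size_map.
have zc : fcycle z c by apply: fcycle_conjg.
have notc x : (x \notin c) = (x \in [:: u; v]).
  rewrite -[x](permKV h) (mem_map (@perm_inj _ h)) -hu -hv !inE !(inj_eq perm_inj).
  by have /setP/(_ (h^-1 x)) := fixE; rewrite !inE.
have zfix x : x \notin c -> z x = x.
  rewrite -[x](permKV h) (mem_map (@perm_inj _ h)) => xc0.
  by rewrite permJ fix0.
exists z, c; split=> //; split=> //.
have [ab ab'] : a != b /\ a' != b'.
  by move: Uab; rewrite /= !inE !negb_or; case/and4P=> /and3P[].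
(* A second conjugation, independent of [h], turns one of the two transpositions into [(u v)]; the
   other then lies inside [c]. *)
have [g gH [ga gb]] := tr2 _ _ _ _ ab uv.
pose p := g a'; pose q := g b'.
have Hpq : tperm u v * tperm p q \in H.
  by rewrite -ga -gb -!tpermJ -conjMg groupJ.
have pq : p != q by rewrite (inj_eq perm_inj).
have pc : p \in c.
  rewrite -[_ \in _]negbK notc -ga -gb !inE !(inj_eq perm_inj).
  move: Uab; rewrite /= !inE !negb_or ![_ == a']eq_sym.
  by case/and4P=> /and3P[_ -> _] /andP[-> _].
have qc : q \in c.
  rewrite -[_ \in _]negbK notc -ga -gb !inE !(inj_eq perm_inj).
  move: Uab; rewrite /= !inE !negb_or ![_ == b']eq_sym.
  by case/and4P=> /and3P[_ _ ->] /andP[_ ->].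
have Hz i x y : tperm u v * tperm x y \in H ->
    tperm u v * tperm ((z ^+ i) x) ((z ^+ i) y) \in H.
  have zu : (z ^+ i) u = u by apply/perm_fix_expg/zfix; rewrite notc !inE eqxx.
  have zv : (z ^+ i) v = v by apply/perm_fix_expg/zfix; rewrite notc !inE eqxx orbT.
  by rewrite -{2}zu -{2}zv -!tpermJ -conjMg groupJr ?groupX.
have [i0] := cycle_generates zc pc qc; rewrite (fcycle_expg _ zc Uc pc).
set i := i0 %% _ => zi.
have lti : i < (2 * m)%N by rewrite -szc ltn_mod; case: (c) pc.
clearbody i.
have ziq : (z ^+ i) q = p.
  have := Hz i _ _ Hpq; rewrite zi => Hq; apply/eqP; apply/idPn => ziqp.
  have Uq : uniq [:: q; p; (z ^+ i) q].
    rewrite /= !inE negb_or eq_sym pq [p == _]eq_sym ziqp !andbT.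
    by apply: contraNneq pq => qz; rewrite -(inj_eq (@perm_inj _ (z ^+ i))) zi -qz.
  case/negP: (no3 _ _ _ Uq); apply: tperm_pair_quotient Hq.
  by rewrite (tpermC q).
have im : i = m.
  have : size c %| i + i by rewrite -(fcycle_expg_fix _ zc Uc pc) expgD permM zi ziq.
  have i0' : i != 0%N by apply: contraNneq pq => i0'; rewrite -zi i0' perm1.
  by rewrite szc; apply: dvdn_double_half.
move=> r rc; have [j <-] := cycle_generates zc pc rc.
have -> : (z ^+ m) ((z ^+ j) p) = (z ^+ j) q.
  by rewrite -zi im -!permM -!expgD addnC.
exact: Hz.
Qed.

(** With the cycle numbered from 0 to 5, [(0 3)(1 4)] times [z ^+ 3 = (0 3)(1 4)(2 5)] is [(2 5)];
    the two factors [(u v)] cancel. *)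
Lemma matching_6cycle_transposition H (z : {perm T}) c u v :
  z \in H -> uniq c -> size c = 6 -> fcycle z c ->
  (forall x, x \notin c -> z x = x) ->
  (forall r, r \in c -> tperm u v * tperm r ((z ^+ 3) r) \in H) ->
  exists x y, x != y /\ tperm x y \in H.
Proof.
move=> zH Uc szc zc zfix Hm; pose n := nth u c.
have zn i : i < 6 -> z (n i) = n (i.+1 %% 6).
  rewrite /n; case: c szc zc {n Uc zfix Hm} => [|? [|? [|? [|? [|? [|? []]]]]]] // _.
  case/and5P=> /eqP z0 /eqP z1 /eqP z2 /eqP z3 /and3P[/eqP z4 /eqP z5 _].
  by case: i => [|[|[|[|[|[|]]]]]].
have nE i j : i < 6 -> j < 6 -> (n i == n j) = (i == j).
  by move=> i6 j6; rewrite nth_uniq ?szc.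
have nc i : i < 6 -> n i \in c by move=> i6; rewrite mem_nth ?szc.
have z3E x : (z ^+ 3) x = z (z (z x)) by rewrite !permM.
have H0 : tperm u v * tperm (n 0) (n 3) \in H.
  by have := Hm _ (nc 0 isT); rewrite z3E !zn.
have H1 : tperm u v * tperm (n 1%N) (n 4) \in H.
  by have := Hm _ (nc 1%N isT); rewrite z3E !zn.
exists (n 2), (n 5); split; first by rewrite nE.
have <- : (tperm u v * tperm (n 0) (n 3))^-1 * (tperm u v * tperm (n 1%N) (n 4))
    * z ^+ 3 = tperm (n 2) (n 5); last first.
  by apply: groupM; [apply: groupM; rewrite ?groupV|apply: groupX].
rewrite invMg !tpermV -(mulgA (tperm (n 0) _)) (mulgA (tperm u v)) tperm2 mul1g.
apply/permP=> x; rewrite !permM.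
have [/(nthP u)[i]|xc] := boolP (x \in c).
  rewrite szc -/(n i) => i6 <- {x}; clearbody n.
  by case: i i6 => [|[|[|[|[|[|]]]]]] // _; do 3!rewrite ?permE /= ?nE ?zn //=.
rewrite !tpermD ?zfix //; first [by apply: contraNneq xc => <-; rewrite nc].
Qed.

Lemma pair_transitive_tperm_groupT H x0 y0 : pair_transitive H ->
  x0 != y0 -> tperm x0 y0 \in H -> H = [set: {perm T}]%G.
Proof.
move=> tr2 xy0 H0; apply: tperm_groupT => x y.
have [->|xy] := eqVneq x y; first by rewrite tperm1.
by have [h hH [<- <-]] := tr2 _ _ _ _ xy0 xy; rewrite -tpermJ groupJ.
Qed.

(** The involution [f] pairs opposite points of [c]. It must commute with [w] on [d], hence act
    there as a power of [w]; a cycle of odd length has no such power of order 2. *)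
Lemma matching_odd_cycle H m l : pair_transitive H -> no_three_cycle H ->
  double_transposition H -> contains_cycle H (2 * m)%N ->
  #|T| = (2 * m)%N.+2 -> contains_cycle H l -> 1 < l -> odd l ->
  l + 2 <= #|T| -> False.
Proof.
move=> tr2 no3 dt cm cardT [w [d [wH Ud szd wd wfix]]] l1 ol lT.
have /card_gt1P[u [v [ud vd uv]]] : 1 < #|~: [set x in d]|.
  by rewrite cardsCs setCK cardsE (card_uniqP Ud) szd; lia.
rewrite !inE in ud vd.
have [z [c [[zH Uc szc zc] [notc zfix Hm]]]] :=
  double_transposition_matching tr2 no3 dt cm cardT uv.
pose f := z ^+ m; have dc x : x \in d -> x \in c.
  move=> xd; rewrite -[_ \in c]negbK notc !inE.
  by apply/norP; split; apply: contraTneq xd => ->.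
have m0 : 0 < m by lia.
have fx x : x \in d -> f x != x.
  move=> /dc xc; rewrite (fcycle_expg_fix _ zc Uc xc) szc; apply/negP => /dvdn_leq.
  by lia.
have wd1 x : x \in d -> w x \in d by move=> xd; apply: (fcycle_mem 1 wd).
have wu : w u = u by apply: wfix.
have wv : w v = v by apply: wfix.
have wf x : x \in d -> w (f x) = f (w x).
  (* Otherwise conjugation by [w] gives [w x] a second partner besides [f (w x)], and the quotient
     is a 3-cycle. *)
  move=> xd; apply/eqP; apply/idPn => wfx.
  have Uw : uniq [:: w x; w (f x); f (w x)].
    rewrite /= !inE negb_or (inj_eq perm_inj) [x == _]eq_sym fx //=.
    by rewrite eq_sym fx ?wd1 ?wfx.
  case/negP: (no3 _ _ _ Uw); apply: (tperm_pair_quotient (u := u) (v := v)); last first.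
    exact/Hm/dc/wd1.
  by rewrite -{1}wu -{1}wv -!tpermJ -conjMg groupJ // Hm // dc.
have fd x : x \in d -> f x \in d.
  move=> xd; apply/idPn => fxd; have := wf x xd; rewrite (wfix _ fxd).
  move/perm_inj => /esym/eqP; rewrite -[w]expg1 (fcycle_expg_fix _ wd Ud xd) szd.
  by rewrite dvdn1; lia.
have [r rd] : exists r, r \in d.
  by case: (d) szd l1 => [<-|r ? _ _] //; exists r; rewrite inE eqxx.
have [j wj] := cycle_generates wd rd (fd r rd).
have wjf k : (w ^+ k) (f r) = f ((w ^+ k) r).
  elim: k => [|k IHk]; first by rewrite !perm1.
  by rewrite !expgSr !permM IHk wf // (fcycle_mem k wd).
(* As [f] is an involution, [l] divides [2 j]; being odd it divides [j], and [f] would fix [r]. *)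
have : (w ^+ (j + j)) r == r.
  rewrite expgD permM wj wjf wj -permM -expgD (fcycle_expg_fix _ zc Uc (dc r rd)).
  by rewrite szc addnn mul2n.
rewrite (fcycle_expg_fix _ wd Ud rd) szd addnn -mul2n.
rewrite Gauss_dvdr ?coprimen2 //.
rewrite -szd -(fcycle_expg_fix _ wd Ud rd) wj => /eqP fr.
by have := fx r rd; rewrite fr eqxx.
Qed.

(** * No two proper subgroups meet all cycle types in degree at least 7 *)

Lemma contains_cycle_odd H l : contains_cycle H l -> 0 < l -> ~~ odd l ->
  exists2 t, t \in H & odd_perm t.
Proof.
case=> t [c [tH Uc <- tc tfix]] l0 ol; exists t => //.
by rewrite (odd_cycle Uc tc tfix).
Qed.

Lemma transitive_or_subset_sum K : point_transitive K \/
  exists2 a, 0 < a < #|T| & forall ls, contains_shape K ls -> subset_sum ls a.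
Proof.
have [|[A cA invA]] := transitive_or_invariant K; [by left | right].
exists #|A| => // ls [s sK]; apply: invariant_card_shape.
exact: invA.
Qed.

Lemma transposition_fixed_block H n : #|T| = n -> point_transitive H ->
  contains_cycle H 2 -> H <> [set: {perm T}]%G ->
  exists b, [/\ 1 < b < n, b %| n
    & forall k, (2 * k <= n)%N -> contains_cycle H (n - k) -> b %| k].
Proof.
move=> cardT trH cyc2 nHT.
have [b [b1 bn bl]] := transposition_block trH cyc2 nHT.
rewrite !cardT in b1 bn bl; exists b; split=> // k kn cHk.
by have := bl _ cHk; rewrite subKn; [apply; lia | lia].
Qed.

Lemma ncycle_shape H n : #|T| = n -> contains_shape H [:: n] -> contains_cycle H #|T|.
Proof.
move=> <- Hn.
apply: (isolate_cycle (ls1 := [::]) (ls2 := [::]) (d := 1)) => //.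
by rewrite coprimen1.
Qed.

Lemma pred_ncycle_shape H n : contains_shape H [:: n.-1; 1%N] ->
  contains_cycle H (n - 1).
Proof.
rewrite subn1 => Hn.
apply: (isolate_cycle (ls1 := [::]) (ls2 := [:: 1%N]) (d := 1)) => //.
by rewrite coprimen1.
Qed.

(** The trace of a covering by conjugates on cycle types, in which conjugation no longer appears. *)
Definition jointly_cover H K := forall ls, sumn ls = #|T| ->
  contains_shape H ls \/ contains_shape K ls.

Lemma transposition_shape2 H n : 7 <= n -> odd n ->
  contains_shape H [:: n - 2; 2] -> contains_cycle H 2.
Proof.
move=> n7 on Hn.
apply: (isolate_cycle (ls1 := [:: n - 2]) (ls2 := [::]) (d := n - 2)) => //=.
  by rewrite dvdnn.
by rewrite coprime2n; lia.
Qed.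

Lemma transposition_shape321 H n : 7 <= n -> ~~ odd n ->
  contains_shape H [:: n - 3; 2; 1%N] -> contains_cycle H 2.
Proof.
move=> n7 on Hn.
apply: (isolate_cycle (ls1 := [:: n - 3]) (ls2 := [:: 1%N]) (d := n - 3)) => //=.
  by rewrite dvdnn dvd1n.
by rewrite coprime2n; lia.
Qed.

(** For even [n] the exponent [3 (n - 5)] is odd and kills both odd cycles. *)
Lemma transposition_shape532 H n : 7 <= n -> ~~ odd n ->
  contains_shape H [:: n - 5; 3; 2] -> contains_cycle H 2.
Proof.
move=> n7 on Hn; have dE : all (dvdn^~ (3 * (n - 5))%N) ([:: n - 5; 3] ++ [::]).
  by rewrite /= dvdn_mull // dvdn_mulr.
apply: (isolate_cycle (ls1 := [:: n - 5; 3]) (ls2 := [::]) Hn dE).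
by rewrite coprime2n oddM; lia.
Qed.

(** The [(n-3)]-cycle from the first type forces blocks of size 3, so 3 divides [n]. Then [n - 5] is
    prime to 6, and the [(n-5)]-cycle from the second type would make 3 divide 5. *)
Lemma transposition_block3 H n : #|T| = n -> 7 <= n -> ~~ odd n ->
  point_transitive H -> H <> [set: {perm T}]%G ->
  contains_shape H [:: n - 3; 2; 1%N] -> contains_shape H [:: n - 5; 3; 2] -> False.
Proof.
move=> cardT n7 on trH nHT H321 H532.
have cyc2 : contains_cycle H 2.
  exact: (transposition_shape321 n7 on).
have [b [b1 bn bk]] := transposition_fixed_block cardT trH cyc2 nHT.
have b3 : b = 3.
  apply/prime_nt_dvdP => //; first by lia.
  apply: bk; first by lia.
  apply: (isolate_cycle (ls1 := [::]) (ls2 := [:: 2; 1%N]) (d := 2)) => //.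
  by rewrite coprimen2; lia.
rewrite b3 in bn bk.
(* Being even and divisible by 3, [n] is at least 12. *)
have /bk : (2 * 5 <= n)%N by lia.
case/(_ _)/negP => //.
apply: (isolate_cycle (ls1 := [::]) (ls2 := [:: 3; 2]) (d := 6)) => //.
rewrite (_ : 6 = 2 * 3)%N // coprimeMr coprimen2 coprime_sym prime_coprime //.
by lia.
Qed.

(** If [K] is transitive, its [(n-1)]-cycle excludes transpositions, so the types that yield one
    fall to [H]. If not, [H] receives every type without a partial sum equal to the size of an
    invariant set of [K]. Either way the blocks of [H] get incompatible sizes. *)
Lemma no_cover_separated H K n : #|T| = n -> 7 <= n ->
  H <> [set: {perm T}]%G -> K <> [set: {perm T}]%G -> jointly_cover H K ->
  contains_shape H [:: n] -> contains_shape K [:: n.-1; 1%N] -> False.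
Proof.
move=> cardT n7 nHT nKT cov Hn Kn.
have trH := ncycle_transitive (ncycle_shape cardT Hn).
rewrite /jointly_cover cardT in cov.
(* The [(n-2)]-cycle would give blocks of size 2, which does not divide an odd [n]. *)
have noH2 : odd n -> ~ contains_shape H [:: n - 2; 2].
  move=> on H22.
  have cyc2 : contains_cycle H 2.
    exact: (transposition_shape2 n7 on).
  have [b [b1 bn bk]] := transposition_fixed_block cardT trH cyc2 nHT.
  have b2 : b = 2.
    apply/prime_nt_dvdP => //; first by lia.
    apply: bk; first by lia.
    apply: (isolate_cycle (ls1 := [::]) (ls2 := [:: 2]) (d := 2)) => //.
    by rewrite coprimen2; lia.
  by rewrite b2 in bn; lia.
have [trK|[a a0 Ka]] := transitive_or_subset_sum K.
  have noK2 : ~ contains_cycle K 2.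
    move=> cyc2.
    have [b [b1 bn bk]] := transposition_fixed_block cardT trK cyc2 nKT.
    have : b %| 1 by apply: bk; [lia | apply: pred_ncycle_shape].
    by rewrite dvdn1; lia.
  have [on|on] := boolP (odd n).
    have [//|K22] := cov [:: n - 2; 2] ltac:(rewrite /=; lia); first exact: noH2.
    apply: noK2; exact: (transposition_shape2 n7 on).
  apply: (transposition_block3 cardT n7 on trH nHT).
    have [//|K321] := cov [:: n - 3; 2; 1%N] ltac:(rewrite /=; lia).
    case: noK2; exact: (transposition_shape321 n7 on).
  have [//|K532] := cov [:: n - 5; 3; 2] ltac:(rewrite /=; lia).
  case: noK2; exact: (transposition_shape532 n7 on).
have Hcov ls : sumn ls = n -> (subset_sum ls a -> False) -> contains_shape H ls.
  by move=> sls nls; have [//|/Ka/nls] := cov ls sls.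
have a1n : a = 1%N \/ a = n.-1 by have := Ka _ Kn; rewrite /=; lia.
have [on|on] := boolP (odd n).
  by apply: noH2 => //; apply: Hcov; rewrite /=; lia.
have H532 : contains_shape H [:: n - 5; 3; 2] by apply: Hcov; rewrite /=; lia.
have cyc2 : contains_cycle H 2.
  exact: (transposition_shape532 n7 on).
have [b [b1 bn bk]] := transposition_fixed_block cardT trH cyc2 nHT.
have [n3|n3] := boolP (3 %| n); last first.
  have b3 : b = 3.
    apply/prime_nt_dvdP => //; first by lia.
    apply: bk; first by lia.
    apply: (isolate_cycle (ls1 := [::]) (ls2 := [:: 3]) (d := 3)) => //.
      by apply: Hcov; rewrite /=; lia.
    by rewrite coprime_sym prime_coprime //; lia.
  by rewrite b3 in bn; rewrite bn in n3.
have b5 : b = 5.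
  apply/prime_nt_dvdP => //; first by lia.
  apply: bk; first by lia.
  apply: (isolate_cycle (ls1 := [::]) (ls2 := [:: 3; 2]) (d := 6)) => //.
  rewrite (_ : 6 = 2 * 3)%N // coprimeMr coprimen2 coprime_sym prime_coprime //.
  by lia.
rewrite b5 in bn bk.
(* Now 30 divides [n], so [n - 7] is prime to 10; the [(n-7)]-cycle from type (n-7,5,2) would make 5
   divide 7. *)
have /bk : (2 * 7 <= n)%N by lia.
case/(_ _)/negP => //.
apply: (isolate_cycle (ls1 := [::]) (ls2 := [:: 5; 2]) (d := 10)) => //.
  by apply: Hcov; rewrite /=; lia.
rewrite (_ : 10 = 2 * 5)%N // coprimeMr coprimen2 coprime_sym prime_coprime //.
by lia.
Qed.

(** [H] is 2-transitive with an odd element, so it has neither transpositions nor 3-cycles, and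
    every type that yields one falls to [K]. *)
Lemma no_cover_pair_transitive H K n : #|T| = n -> 7 <= n ->
  H <> [set: {perm T}]%G -> K <> [set: {perm T}]%G -> jointly_cover H K ->
  contains_shape H [:: n] -> contains_shape H [:: n.-1; 1%N] -> False.
Proof.
move=> cardT n7 nHT nKT cov Hn Hn1.
have cn := ncycle_shape cardT Hn; have cn1 := pred_ncycle_shape Hn1.
have trH := ncycle_transitive cn.
have tr2 : pair_transitive H.
  by apply: cycle_pair_transitive => //; rewrite cardT -subn1.
rewrite /jointly_cover cardT in cov.
have noH2 : ~ contains_cycle H 2.
  case/transposition2=> x [y [xy Hxy]]; apply: nHT.
  exact: pair_transitive_tperm_groupT tr2 xy Hxy.
have [t tH ot] : exists2 t, t \in H & odd_perm t.
  have [on|on] := boolP (odd n).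
    by apply: (contains_cycle_odd cn1); lia.
  by rewrite cardT in cn; apply: (contains_cycle_odd cn); lia.
have no3 : no_three_cycle H.
  move=> x y z Uxyz; apply/negP => Hxyz; apply: nHT.
  exact: odd_three_cycle_groupT tr2 Uxyz Hxyz tH ot.
have noH3 : ~ contains_cycle H 3.
  by case/three_cycle=> x [y [z [/no3/negP]]].
(* These sizes would force type (n-4,3,1) into [H] when 3 divides [n], and (n-3,3) otherwise; in
   both cases a power is a 3-cycle. *)
have no2sum a : (forall ls, contains_shape K ls -> subset_sum ls a) ->
    a <> 2 /\ a <> n - 2.
  move=> Ka; suffices : ~ (a = 2 \/ a = n - 2) by lia.
  move=> a2; apply: noH3.
  have Hcov ls : sumn ls = n -> (subset_sum ls a -> False) -> contains_shape H ls.
    by move=> sls nls; have [//|/Ka/nls] := cov ls sls.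
  have [n3|n3] := boolP (3 %| n).
    apply: (isolate_cycle (ls1 := [:: n - 4]) (l := 3) (ls2 := [:: 1%N]) (d := n - 4)).
    - by apply: Hcov; rewrite /=; lia.
    - by rewrite /= dvdnn dvd1n.
    by rewrite prime_coprime //; lia.
  apply: (isolate_cycle (ls1 := [:: n - 3]) (l := 3) (ls2 := [::]) (d := n - 3)).
  - by apply: Hcov; rewrite /=; lia.
  - by rewrite /= dvdnn.
  by rewrite prime_coprime //; lia.
have [on|on] := boolP (odd n).
  have K22 : contains_shape K [:: n - 2; 2].
    have [H22|//] := cov [:: n - 2; 2] ltac:(rewrite /=; lia).
    case: noH2; exact: (transposition_shape2 n7 on).
  have [trK|[a a0 Ka]] := transitive_or_subset_sum K.
    have cyc2 : contains_cycle K 2.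
      exact: (transposition_shape2 n7 on).
    have [b [b1 bn bk]] := transposition_fixed_block cardT trK cyc2 nKT.
    have b2 : b = 2.
      apply/prime_nt_dvdP => //; first by lia.
      apply: bk; first by lia.
      apply: (isolate_cycle (ls1 := [::]) (ls2 := [:: 2]) (d := 2)) => //.
      by rewrite coprimen2; lia.
    by rewrite b2 in bn; lia.
  by have := no2sum a Ka; have := Ka _ K22; rewrite /=; lia.
have K321 : contains_shape K [:: n - 3; 2; 1%N].
  have [H321|//] := cov [:: n - 3; 2; 1%N] ltac:(rewrite /=; lia).
  case: noH2; exact: (transposition_shape321 n7 on).
have K532 : contains_shape K [:: n - 5; 3; 2].
  have [H532|//] := cov [:: n - 5; 3; 2] ltac:(rewrite /=; lia).
  case: noH2; exact: (transposition_shape532 n7 on).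
have [trK|[a a0 Ka]] := transitive_or_subset_sum K.
  exact: (transposition_block3 cardT n7 on trK nKT).
(* Strictly between 0 and [n], the partial sums common to (n-3,2,1) and (n-5,3,2) are 2, 3, [n - 3]
   and [n - 2]. *)
have a3 : a = 3 \/ a = n - 3.
  by move: (no2sum a Ka) (Ka _ K321) (Ka _ K532) a0 n7; rewrite cardT /=; clear; lia.
have Hcov ls : sumn ls = n -> (subset_sum ls a -> False) -> contains_shape H ls.
  by move=> sls nls; have [//|/Ka/nls] := cov ls sls.
pose m := (n - 2)./2.
have n2m : n = (2 * m)%N.+2 by rewrite /m; lia.
have c2m : contains_cycle H (2 * m)%N.
  apply: (isolate_cycle (ls1 := [::]) (ls2 := [:: 1%N; 1%N]) (d := 1)) => //.
    by apply: Hcov; rewrite /=; lia.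
  by rewrite coprimen1.
have cardTm : #|T| = (2 * m)%N.+2 by rewrite cardT.
(* For [n = 8] the type (n-5,4,1) used below has the partial sum 3; (4,2,2) provides the double
   transposition instead. *)
have [n8|n8] := eqVneq n 8.
  have dt : double_transposition H.
    apply: (four_cycle_double_transposition (ls1 := [::])
      (ls2 := [:: 2; 2]) (k := 1)) => //.
    by apply: Hcov; rewrite /=; lia.
  have m3 : m = 3 by lia.
  have /card_gt1P[u [v [_ _ uv]]] : 1 < #|T| by lia.
  have [z [c [[zH Uc szc zc] [_ zfix Hm]]]] :=
    double_transposition_matching tr2 no3 dt c2m cardTm uv.
  rewrite m3 in szc Hm.
  have [x [y [xy Hxy]]] := matching_6cycle_transposition zH Uc szc zc zfix Hm.
  by apply: nHT; apply: pair_transitive_tperm_groupT tr2 xy Hxy.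
have H541 : contains_shape H [:: n - 5; 4; 1%N].
  by apply: Hcov; rewrite /=; lia.
have dt : double_transposition H.
  apply: (four_cycle_double_transposition (ls1 := [:: n - 5])
    (ls2 := [:: 1%N]) (k := n - 5)) => //=.
    by rewrite dvdn_mull // dvd1n.
  by lia.
have cl : contains_cycle H (n - 5).
  apply: (isolate_cycle (ls1 := [::]) (ls2 := [:: 4; 1%N]) (d := 4)) => //.
  by rewrite (_ : 4 = 2 * 2)%N // coprimeMr coprimen2; lia.
by apply: (matching_odd_cycle tr2 no3 dt c2m cardTm cl); rewrite ?cardT; lia.
Qed.

Lemma jointly_coverC H K : jointly_cover H K -> jointly_cover K H.
Proof. by move=> cov ls /cov[]; [right | left]. Qed.

Lemma no_cover H K : 7 <= #|T| ->
  H <> [set: {perm T}]%G -> K <> [set: {perm T}]%G -> ~ jointly_cover H K.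
Proof.
move=> n7 nHT nKT cov.
have sz1 : sumn [:: #|T|.-1; 1%N] = #|T|.
  by rewrite /= addn0 addn1 prednK // (leq_trans _ n7).
have [Hn|Kn] := cov [:: #|T|] (addn0 _).
  have [Hn1|Kn1] := cov _ sz1.
    exact: (no_cover_pair_transitive (erefl _) n7 nHT nKT cov).
  exact: (no_cover_separated (erefl _) n7 nHT nKT cov).
have [Hn1|Kn1] := cov _ sz1.
  exact: (no_cover_separated (erefl _) n7 nKT nHT (jointly_coverC cov)).
exact: (no_cover_pair_transitive (erefl _) n7 nKT nHT (jointly_coverC cov)).
Qed.

Lemma ncycle_transposition_groupT H : 2 < #|T| -> contains_shape H [:: #|T|] ->
  contains_shape H [:: #|T|.-1; 1%N] -> contains_cycle H 2 ->
  H = [set: {perm T}]%G.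
Proof.
move=> n3 Hn Hn1 /transposition2[x [y [xy Hxy]]].
apply: pair_transitive_tperm_groupT xy Hxy; apply: cycle_pair_transitive.
  exact/ncycle_transitive/(ncycle_shape (erefl _)).
by rewrite -subn1; apply: pred_ncycle_shape.
Qed.

End CycleType.

(** * Coverings by the conjugates of two subgroups *)

Definition conj_covers (gT : finGroupType) (H K : {set gT}) :=
  forall x, exists g, x ^ g \in H \/ x ^ g \in K.

Lemma covering_conj_covers (gT : finGroupType) (H K : {group gT}) :
  covering [set: gT] ([set (H :^ g)%G | g in [set: gT]] :|:
                      [set (K :^ g)%G | g in [set: gT]]) ->
  conj_covers H K.
Proof.
case=> _ /setP cover _ x; have := cover x; rewrite [RHS]inE.
case/bigcupP=> L /setUP[] /imsetP[g _ ->].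
  by rewrite /= mem_conjg => xH; exists g^-1; left.
by rewrite /= mem_conjg => xK; exists g^-1; right.
Qed.

Lemma conj_covers_jointly (T : finType) (H K : {group {perm T}}) :
  conj_covers H K -> jointly_cover H K.
Proof.
move=> cov ls /shape_exists[s sls]; have [g [sH|sK]] := cov s.
  by left; exists (s ^ g) => //; apply: has_shapeJ.
by right; exists (s ^ g) => //; apply: has_shapeJ.
Qed.

Lemma conj_covers_groupT (T : finType) (K : {group {perm T}}) :
  2 < #|T| -> (forall s, exists g, s ^ g \in K) -> K = [set: {perm T}]%G.
Proof.
move=> n3 cov; have Kls ls : sumn ls = #|T| -> contains_shape K ls.
  move=> sls; have [|//|//] := @conj_covers_jointly T K K _ ls sls.
  by move=> s; have [g] := cov s; exists g; left.
apply: ncycle_transposition_groupT => //.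
- by apply: Kls; rewrite /= addn0.
- by apply: Kls; rewrite /= addn0 addn1 prednK // (leq_trans _ n3).
apply: (isolate_cycle (ls1 := [::]) (ls2 := nseq (#|T| - 2) 1%N) (d := 1)) => //.
  by apply: Kls; rewrite /= sumn_nseq mul1n subnKC // ltnW.
by rewrite all_nseq dvd1n orbT.
Qed.

Lemma conj_covers_starstar (T : finType) (H K : {group {perm T}}) :
  2 < #|T| -> H \proper [set: {perm T}] -> K \proper [set: {perm T}] ->
  conj_covers H K -> starstar_coverable [set: {perm T}]%G.
Proof.
move=> n3 pH pK cov; exists H, K; split=> //.
have properJ (L : {group {perm T}}) g : L \proper [set: {perm T}] ->
    (L :^ g) \proper [set: {perm T}].
  rewrite !properT; apply: contraNneq => LT.
  by rewrite -(conjsgK g L) LT conjTg.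
have not_cov (L : {group {perm T}}) : L \proper [set: {perm T}] ->
    ~ forall s, exists g, s ^ g \in L.
  by move=> pL /(conj_covers_groupT n3) LT; rewrite LT properxx in pL.
(* If a conjugate of [L] lies in a conjugate of [M], the conjugates of [M] alone cover the group. *)
have anti (L M : {group {perm T}}) g h : M \proper [set: {perm T}] ->
    conj_covers L M -> ~ L :^ g \subset M :^ h.
  move=> pM LM LgMh; apply: (not_cov M pM) => s.
  have [k [sL|sM]] := LM s; last by exists k.
  exists (k * g * h^-1); rewrite !conjgM -mem_conjg.
  by rewrite (subsetP LgMh) // memJ_conjg.
split.
- by move=> L /setUP[] /imsetP[g _ ->]; apply: properJ.
- apply/eqP; rewrite eqEsubset subsetT /=; apply/subsetP=> s _; apply/bigcupP.
  have [g [sH|sK]] := cov s.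
    exists (H :^ g^-1)%G; last by rewrite /= mem_conjgV.
    by rewrite inE imset_f ?inE.
  exists (K :^ g^-1)%G; last by rewrite /= mem_conjgV.
  by apply/setUP; right; rewrite imset_f ?inE.
have covC : conj_covers K H.
  by move=> s; have [g [sH|sK]] := cov s; exists g; [right | left].
have same (L : {group {perm T}}) g h : L :^ g <> L :^ h -> ~ L :^ g \subset L :^ h.
  by move=> neq sub; apply: neq; apply/eqP; rewrite eqEcard sub !cardJg leqnn.
move=> L M /setUP[] /imsetP[g _ ->] /setUP[] /imsetP[h _ ->] neq /=.
- by apply: same => eqg; apply: neq; apply: val_inj.
- exact: anti.
- exact: anti.
- by apply: same => eqg; apply: neq; apply: val_inj.
Qed.

(* Unlike [all] and [has], these do not evaluate the whole list under the
   call-by-value strategy of [vm_compute]. *)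
Fixpoint lazy_all (A : Type) (p : pred A) s :=
  if s is x :: s' then if p x then lazy_all p s' else false else true.
Fixpoint lazy_has (A : Type) (p : pred A) s :=
  if s is x :: s' then if p x then true else lazy_has p s' else false.

Lemma lazy_allE (A : Type) (p : pred A) s : lazy_all p s = all p s.
Proof. by elim: s => //= x s ->. Qed.

Lemma lazy_hasE (A : Type) (p : pred A) s : lazy_has p s = has p s.
Proof. by elim: s => //= x s ->. Qed.

(** * Automorphism groups of relations and their computation *)

Section RelationAutomorphisms.
Variables (n : nat) (R : nat -> nat -> nat -> bool).
Implicit Types s g : 'S_n.

(** Three arguments accommodate midpoints; simpler relations ignore some of them. *)
Definition aut_rel := [set s : 'S_n |
  [forall x, forall y, forall z, R (s x) (s y) (s z) == R x y z]].

Lemma aut_relP s :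
  reflect (forall x y z, R (s x) (s y) (s z) = R x y z) (s \in aut_rel).
Proof.
rewrite inE; apply: (iffP forallP) => [sR x y z | sR x].
  by have /forallP/(_ y)/forallP/(_ z)/eqP := sR x.
by apply/forallP=> y; apply/forallP=> z; apply/eqP.
Qed.

Lemma group_set_aut_rel : group_set aut_rel.
Proof.
apply/group_setP; split=> [|s g /aut_relP sR /aut_relP gR].
  by apply/aut_relP=> x y z; rewrite !perm1.
by apply/aut_relP=> x y z; rewrite !permM gR.
Qed.

Canonical aut_rel_group := Group group_set_aut_rel.

(** One-line notation in plain naturals, suited to evaluation. *)
Definition word s := [seq val (s i) | i <- enum 'I_n].

Lemma nth_word s (i : 'I_n) : nth 0 (word s) i = s i.
Proof. by rewrite (nth_map i) ?size_enum_ord // nth_ord_enum. Qed.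

Lemma word_perm s : word s \in permutations (iota 0 n).
Proof.
rewrite mem_permutations uniq_perm ?iota_uniq //.
  by rewrite map_inj_uniq ?enum_uniq // => i j /val_inj/perm_inj.
move=> k; rewrite mem_iota; apply/mapP/idP => [[i _ ->]|/= kn].
  by rewrite /= ltn_ord.
by exists (s^-1 (Ordinal kn)); rewrite ?mem_enum // permKV.
Qed.

Lemma word_surj m : m \in permutations (iota 0 n) -> exists g, word g = m.
Proof.
rewrite mem_permutations => pm.
have szm : size m = n by rewrite (perm_size pm) size_iota.
have ltm (i : 'I_n) : nth 0 m i < n.
  have : nth 0 m i \in iota 0 n by rewrite -(perm_mem pm) mem_nth ?szm.
  by rewrite mem_iota.
have injm : injective (fun i => Ordinal (ltm i)).
  move=> i j [] /eqP; rewrite nth_uniq ?szm //; last by rewrite (perm_uniq pm) iota_uniq.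
  by move/eqP/val_inj.
exists (perm injm); apply: (@eq_from_nth _ 0); first by rewrite size_map size_enum_ord szm.
move=> i; rewrite size_map size_enum_ord => ltin.
by rewrite (nth_word _ (Ordinal ltin)) permE.
Qed.

(* With [l = word s] and [m = word g], this says that [s ^ g] preserves [R]. *)
Definition preserves (l m : seq nat) :=
  let p := nth 0 m in let sp x := p (nth 0 l x) in
  lazy_all (fun x => lazy_all (fun y => lazy_all (fun z =>
    R (sp x) (sp y) (sp z) == R (p x) (p y) (p z))
  (iota 0 n)) (iota 0 n)) (iota 0 n).

Lemma all_iotaP (p : pred nat) :
  reflect (forall i : 'I_n, p i) (all p (iota 0 n)).
Proof.
apply: (iffP allP) => [pn i | pn i]; first by rewrite pn // mem_iota ltn_ord.
by rewrite mem_iota => ltin; apply: (pn (Ordinal ltin)).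
Qed.

(** As [s ^ g] sends [g i] to [g (s i)], the test runs over the images under [g], which are all the
    points. *)
Lemma preservesE s g : preserves (word s) (word g) = (s ^ g \in aut_rel).
Proof.
rewrite /preserves lazy_allE; apply/all_iotaP/aut_relP=> sgR.
  move=> x y z; rewrite -[x](permKV g) -[y](permKV g) -[z](permKV g) !permJ.
  have := sgR (g^-1 x); rewrite lazy_allE => /all_iotaP/(_ (g^-1 y)).
  by rewrite lazy_allE => /all_iotaP/(_ (g^-1 z)); rewrite !nth_word => /eqP.
move=> x; rewrite lazy_allE; apply/all_iotaP=> y; rewrite lazy_allE.
have sgE i : g (s i) = (s ^ g) (g i) by rewrite permJ.
by apply/all_iotaP=> z; rewrite !nth_word !sgE sgR.
Qed.

(** [iota 0 n] is the word of the identity: the test looks for a permutation that does not itself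
    preserve [R]. *)
Lemma aut_rel_proper :
  ~~ lazy_all (fun l => preserves l (iota 0 n)) (permutations (iota 0 n)) ->
  aut_rel \proper [set: 'S_n].
Proof.
rewrite lazy_allE properT => notall; apply/eqP => autT.
have [|g gE] := @word_surj (iota 0 n); first by rewrite mem_permutations.
case/allP: notall => l /word_surj[s <-].
by rewrite -gE preservesE autT inE.
Qed.

End RelationAutomorphisms.

(** The [if] in place of a disjunction avoids evaluating the second test when the first succeeds. *)
Lemma aut_rel_starstar n R1 R2 : 2 < n ->
  (let ps := permutations (iota 0 n) in
   [&& ~~ lazy_all (fun l => preserves n R1 l (iota 0 n)) ps,
       ~~ lazy_all (fun l => preserves n R2 l (iota 0 n)) ps
     & lazy_all (fun l => lazy_has (fun m =>
         if preserves n R1 l m then true else preserves n R2 l m) ps) ps]) ->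
  starstar_coverable [set: 'S_n]%G.
Proof.
move=> n3 /and3P[pR1 pR2]; rewrite lazy_allE => /allP cov.
apply: (@conj_covers_starstar _ (aut_rel_group n R1) (aut_rel_group n R2)).
- by rewrite card_ord.
- exact: aut_rel_proper.
- exact: aut_rel_proper.
move=> s; have := cov _ (word_perm s); rewrite lazy_hasE.
case/hasP=> m /word_surj[g <-]; rewrite !preservesE => sg.
by exists g; apply/orP; move: sg; case: ifP.
Qed.

Theorem theorem4p2 (n : nat) (hn : 1 <= n) :
  starstar_coverable [set: 'S_n]%G <-> 3 <= n <= 6.
Proof.
split=> [[H [K [pH pK /covering_conj_covers cov]]]|].
  have properT_neq (L : {group 'S_n}) : L \proper [set: 'S_n] -> L <> [set: 'S_n]%G.
    by move=> + LT; rewrite LT properxx.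
  apply/andP; split; last first.
    rewrite leqNgt; apply/negP => n7.
    apply: (no_cover _ (properT_neq _ pH) (properT_neq _ pK)).
      by rewrite card_ord.
    exact: conj_covers_jointly.
  rewrite ltnNge; apply/negP => n2.
  (* For [n] at most 2, [n! = n]: proper subgroups are trivial, and exist only for [n = 2]. *)
  have cardS : #|[set: 'S_n]| = n by rewrite cardsT card_Sn; case: (n) hn n2 => [|[|[]]].
  have trivial_sub (L : {group 'S_n}) : L \proper [set: 'S_n] -> L :=: 1 /\ 1 < n.
    move/proper_card; rewrite cardS => ltL; have L0 := cardG_gt0 L.
    by split; [apply: card1_trivg; lia | lia].
  have [H1 n1] := trivial_sub _ pH; have [K1 _] := trivial_sub _ pK.
  have : [set: 'S_n] \subset [1].
    apply/subsetP=> s _; have [g] := cov s; rewrite H1 K1 => sg.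
    have: s ^ g \in [1] by case: sg.
    by rewrite !inE conjg_eq1.
  by move/subset_leq_card; rewrite cardS cards1 leqNgt n1.
(* The two automorphism groups are [A_3] and [S_2], [D_8] and [S_3],
   [AGL(1,5)] (preserving midpoints modulo 5) and [S_2 x S_3], [S_3 wr S_2]
   and [S_5]. *)
case: n {hn} => [|[|[|[|[|[|[|]]]]]]] //= _.
- apply: (aut_rel_starstar (R1 := fun x y _ => y == x.+1 %% 3)
    (R2 := fun x _ _ => x == 0)); [by [] | by vm_compute].
- apply: (aut_rel_starstar (R1 := fun x y _ => odd x == odd y)
    (R2 := fun x _ _ => x == 0)); [by [] | by vm_compute].
- apply: (aut_rel_starstar (R1 := fun x y z => (x + z) %% 5 == (2 * y) %% 5)
    (R2 := fun x _ _ => (x == 0) || (x == 2))); [by [] | by vm_compute].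
- apply: (aut_rel_starstar (R1 := fun x y _ => odd x == odd y)
    (R2 := fun x _ _ => x == 0)); [by [] | by vm_compute].
Qed.
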